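(* For every positive integer $n$, during a complete run of $\mathrm{RuleDesc}(n)$, the read statements ''$m\leftarrow d_k$'' (both occurrences together) are executed a total of exactly $\sum_{x=1}^{n}p(x) - n$ times.
   Context: $p(n)$ denotes the number of partitions of $n$. The procedure $\mathrm{RuleDesc}(n)$, for $n>0$, operates on an array $d$ as follows and visits every descending composition of $n$ (a sequence of positive integers in nonincreasing order summing to $n$) exactly once, in reverse lexicographic order: 1. $d_1\leftarrow n$; $k\leftarrow 1$; visit $\langle d_1\rangle$. 2. While $k\ne n$: - $\ell\leftarrow k$; $m\leftarrow d_k$. - While $m=1$: $k\leftarrow k-1$; $m\leftarrow d_k$. - $n'\leftarrow m+\ell-k$; $m\leftarrow m-1$. - While $m<n'$: $d_k\leftarrow m$; $n'\leftarrow n'-m$; $k\leftarrow k+1$. - $d_k\leftarrow n'$; visit $\langle d_1,\dots,d_k\rangle$. *)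

(* Defs.v *)
From HB Require Import structures.
From mathcomp Require Import all_boot all_order all_algebra.
Set Implicit Arguments.
Unset Strict Implicit.
Unset Printing Implicit Defensive.
Import Order.TTheory GRing.Theory Num.Theory.
Local Open Scope ring_scope.

Definition is_partition (n : nat) (s : seq nat) : bool :=
  [&& sorted geq s, 0%N \notin s & sumn s == n].

(* The bounds (at most n parts, each at most n) only serve to make the type
   finite: they hold for every partition of n, see [p_enum]. *)
Definition p (n : nat) : nat :=
  #|[set s : n.-bseq 'I_n.+1 | is_partition n (map val s)]|.

Lemma is_partition_bounds n s :
  is_partition n s -> (size s <= n)%N /\ all (fun x => x < n.+1)%N s.
Proof.
case/and3P=> _ + /eqP <-; elim: s => [|x s IHs] //=.
rewrite in_cons negb_or eq_sym -lt0n => /andP[x0 /IHs[szs als]].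
split; first by rewrite -add1n leq_add.
rewrite ltnS leq_addr /=; apply: sub_all als => y.
by rewrite !ltnS => /leq_trans; apply; rewrite leq_addl.
Qed.

Lemma p_enum n (l : seq (seq nat)) :
  uniq l -> (forall s, (s \in l) = is_partition n s) -> size l = p n.
Proof.
move=> Ul lP; pose f (s : n.-bseq 'I_n.+1) := map val s.
have f_inj : injective f.
  by move=> s t /(inj_map val_inj) st; apply: val_inj.
rewrite /p cardE -(size_map f); apply/perm_size/uniq_perm => //.
  by rewrite map_inj_uniq ?enum_uniq.
move=> s; rewrite lP; apply/idP/mapP => [sP|[t]]; last first.
  by rewrite mem_enum inE => tP ->.
have [szs als] := is_partition_bounds sP.
have sK : map val (map (@inord n) s) = s.
  by rewrite -map_comp map_id_in // => x /(allP als) xn /=; rewrite inordK.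
have szt : (size (map (@inord n) s) <= n)%N by rewrite size_map.
by exists (Bseq szt); rewrite ?mem_enum ?inE /f /= sK.
Qed.

(* Variables and array cells hold integers, so subtraction is never truncated.
   The array d is only read through [ReadArr], apart from visits. *)

Inductive var := K | L | M | N'.

Definition var_eqb (x y : var) : bool :=
  match x, y with
  | K, K | L, L | M, M | N', N' => true
  | _, _ => false
  end.

Lemma var_eqP : Equality.axiom var_eqb.
Proof. by case; case; constructor. Qed.

HB.instance Definition _ := hasDecEq.Build var var_eqP.

Inductive expr :=
| EConst of int
| EVar of var
| EAdd of expr & expr
| ESub of expr & expr.

Inductive test :=
| BEq of expr & expr
| BNe of expr & expr
| BLt of expr & expr.

Inductive cmd :=
| Assign of var & expr        (* x <- e *)
| ReadArr of var & expr          (* x <- d_e *)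
| WriteArr of expr & expr        (* d_e <- e' *)
| Visit of expr               (* visit <d_1, ..., d_e> *)
| Seq of cmd & cmd
| While of test & cmd.

Record state := State { env : var -> int; arr : int -> int }.

Definition set_var (s : state) (x : var) (v : int) : state :=
  State [eta env s with x |-> v] (arr s).

Definition set_arr (s : state) (i v : int) : state :=
  State (env s) [eta arr s with i |-> v].

Fixpoint eval (s : state) (e : expr) : int :=
  match e with
  | EConst c => c
  | EVar x => env s x
  | EAdd e1 e2 => eval s e1 + eval s e2
  | ESub e1 e2 => eval s e1 - eval s e2
  end.

Definition holds (s : state) (b : test) : bool :=
  match b with
  | BEq e1 e2 => eval s e1 == eval s e2
  | BNe e1 e2 => eval s e1 != eval s e2
  | BLt e1 e2 => eval s e1 < eval s e2
  end.

Inductive event := Read | Visited of seq int.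

Definition is_read (e : event) : bool := if e is Read then true else false.

(* [exec c s t s']: started in s, c terminates in s', and t is the sequence of
   read statements and visits executed on the way. *)
Inductive exec : cmd -> state -> seq event -> state -> Prop :=
| ExecAssign s x e :
    exec (Assign x e) s [::] (set_var s x (eval s e))
| ExecReadArr s x e :
    exec (ReadArr x e) s [:: Read] (set_var s x (arr s (eval s e)))
| ExecWriteArr s e1 e2 :
    exec (WriteArr e1 e2) s [::] (set_arr s (eval s e1) (eval s e2))
| ExecVisit s e :
    exec (Visit e) s
      [:: Visited [seq arr s i%:Z | i <- iota 1 `|eval s e|%N]] s
| ExecSeq c1 c2 s1 t1 s2 t2 s3 :
    exec c1 s1 t1 s2 -> exec c2 s2 t2 s3 ->
    exec (Seq c1 c2) s1 (t1 ++ t2) s3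
| ExecWhileFalse b c s :
    ~~ holds s b -> exec (While b c) s [::] s
| ExecWhileTrue b c s1 t1 s2 t2 s3 :
    holds s1 b -> exec c s1 t1 s2 -> exec (While b c) s2 t2 s3 ->
    exec (While b c) s1 (t1 ++ t2) s3.

Declare Scope prog_scope.
Delimit Scope prog_scope with prog.
Bind Scope prog_scope with cmd expr test.

Coercion EVar : var >-> expr.
Coercion EConst : int >-> expr.
Notation "e1 + e2" := (EAdd e1 e2) : prog_scope.
Notation "e1 - e2" := (ESub e1 e2) : prog_scope.
Notation "e1 = e2" := (BEq e1 e2) : prog_scope.
Notation "e1 != e2" := (BNe e1 e2) : prog_scope.
Notation "e1 < e2" := (BLt e1 e2) : prog_scope.
Notation "x <-- e" := (Assign x e) (at level 75) : prog_scope.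
Notation "x <-- 'd[' e ]" := (ReadArr x e)
  (at level 75, e at level 65, format "x  <--  'd[' e ]") : prog_scope.
Notation "'d[' e1 ] <-- e2" := (WriteArr e1 e2)
  (at level 75, e1 at level 65, format "'d[' e1 ]  <--  e2") : prog_scope.
Notation "c1 ;; c2" := (Seq c1 c2)
  (at level 81, right associativity) : prog_scope.
Notation "'while' b 'do' c 'od'" := (While b c)
  (at level 0, b at level 80, c at level 200) : prog_scope.

Definition RuleDesc (n : nat) : cmd := (
  d[1%:Z] <-- n%:Z;;
  K <-- 1%:Z;;
  Visit K;;
  while K != n%:Z do
    L <-- K;;
    M <-- d[K];;
    while M = 1%:Z do
      K <-- K - 1%:Z;;
      M <-- d[K]
    od;;
    N' <-- M + L - K;;
    M <-- M - 1%:Z;;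
    while M < N' do
      d[K] <-- M;;
      N' <-- N' - M;;
      K <-- K + 1%:Z
    od;;
    d[K] <-- N';;
    Visit K
  od)%prog.

(* Main.v *)
(* A step of the main loop leading away from the partition q executes one read
   plus one for each part of q equal to 1, and every partition other than
   1^n is left exactly once.  Removing a part 1 shows that the parts equal
   to 1 in all the partitions of n number p(0) + ... + p(n-1), so the total is
   p(n) + (p(0) + ... + p(n-1)) minus the contribution n + 1 of 1^n.  Both the
   run and the count follow the recursion splitting the partitions of n with
   parts at most m according to whether m is a part: the program first goes
   through those with first part m, ending at m, 1, ..., 1, and then through
   the others. *)
Require Import Defs.
From mathcomp Require Import all_boot all_order all_algebra.
From mathcomp Require Import zify.
Set Implicit Arguments.
Unset Strict Implicit.
Unset Printing Implicit Defensive.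
Import Order.TTheory GRing.Theory Num.Theory.
Local Open Scope ring_scope.

(** * Determinism and read counts of executions *)

(** Reduces the claim about every run to the one run constructed below. *)
Lemma exec_deterministic c s t1 s1 t2 s2 :
  exec c s t1 s1 -> exec c s t2 s2 -> t1 = t2 /\ s1 = s2.
Proof.
move=> E1; elim: E1 t2 s2 => {c s t1 s1}.
- by move=> s x e t s' E; inversion E; subst.
- by move=> s x e t s' E; inversion E; subst.
- by move=> s x e t s' E; inversion E; subst.
- by move=> s x t s' E; inversion E; subst.
- move=> c1 c2 s1 t1 s2 t2 s3 _ IH1 _ IH2 t s' E.
  inversion E as [| | | |? ? ? u1 s4 u2 ? F1 F2| |]; subst.
  by have [? ?] := IH1 _ _ F1; subst; have [? ?] := IH2 _ _ F2; subst.
- move=> b c s nb t s' E; inversion E as [| | | | | |? ? ? ? ? ? ? b1]; subst => //.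
  by rewrite b1 in nb.
- move=> b c s1 t1 s2 t2 s3 b1 _ IH1 _ IH2 t s' E.
  inversion E as [| | | | |? ? ? nb|? ? ? u1 s4 u2 ? ? F1 F2]; subst.
    by rewrite b1 in nb.
  by have [? ?] := IH1 _ _ F1; subst; have [? ?] := IH2 _ _ F2; subst.
Qed.

Definition runs (c : cmd) (s : state) (r : nat) (s' : state) : Prop :=
  exists2 t, exec c s t s' & count is_read t = r.

Lemma runs_assign s x e : runs (Assign x e) s 0 (set_var s x (eval s e)).
Proof. by exists [::] => //; constructor. Qed.

Lemma runs_read s x e : runs (ReadArr x e) s 1 (set_var s x (arr s (eval s e))).
Proof. by exists [:: Read] => //; constructor. Qed.

Lemma runs_write s e1 e2 :
  runs (WriteArr e1 e2) s 0 (set_arr s (eval s e1) (eval s e2)).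
Proof. by exists [::] => //; constructor. Qed.

Lemma runs_visit s e : runs (Visit e) s 0 s.
Proof. by eexists; first constructor. Qed.

Lemma runs_seq c1 c2 s1 r1 s2 r2 s3 :
  runs c1 s1 r1 s2 -> runs c2 s2 r2 s3 -> runs (Seq c1 c2) s1 (r1 + r2) s3.
Proof.
move=> [t1 E1 <-] [t2 E2 <-]; exists (t1 ++ t2); last by rewrite count_cat.
exact: ExecSeq E1 E2.
Qed.

Lemma runs_while_false b c s : ~~ holds s b -> runs (While b c) s 0 s.
Proof. by move=> nb; exists [::] => //; constructor. Qed.

Lemma runs_while_true b c s1 r1 s2 r2 s3 :
    holds s1 b -> runs c s1 r1 s2 -> runs (While b c) s2 r2 s3 ->
  runs (While b c) s1 (r1 + r2) s3.
Proof.
move=> b1 [t1 E1 <-] [t2 E2 <-]; exists (t1 ++ t2); last by rewrite count_cat.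
exact: ExecWhileTrue E1 E2.
Qed.

(** * Enumeration of partitions with bounded parts *)

(* The partitions of n with parts at most m, in reverse lexicographic order. *)
Fixpoint desc (m : nat) : nat -> seq (seq nat) :=
  if m is m'.+1 then
    fix desc_m n :=
      (if (n - m')%N is k.+1 then map (cons m) (desc_m k) else [::]) ++ desc m' n
  else fun n => if n is 0 then [:: [::]] else [::].

(** The nested [fix] matches on [n - m'] to make its recursive call structural; here the recursion
    is restated with a plain comparison. *)
Lemma descS m n : desc m.+1 n =
  (if (m < n)%N then map (cons m.+1) (desc m.+1 (n - m.+1)) else [::])
  ++ desc m n.
Proof.
rewrite -subn_gt0 subnS; case: n => [|n] //.
by rewrite [LHS]/=; case: (n.+1 - m)%N.
Qed.

Lemma desc_n0 m : desc m 0 = [:: [::]].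
Proof. by elim: m => // m IHm; rewrite descS ltn0. Qed.

Lemma desc1 n : desc 1 n = [:: nseq n 1%N].
Proof. by elim: n => // n IHn; rewrite descS subn1 [_.-1]/= IHn. Qed.

Lemma desc_neq_nil m n : (0 < m)%N -> desc m n != [::].
Proof.
case: m => // m _; elim: m => [|m IHm]; first by rewrite desc1.
by rewrite descS -size_eq0 size_cat addn_eq0 negb_and !size_eq0 IHm orbT.
Qed.

Lemma is_partition_cons n x q : is_partition n (x :: q) =
  [&& (0 < x)%N, (x <= n)%N, is_partition (n - x) q & all (fun y => y <= x)%N q].
Proof.
rewrite /is_partition in_cons negb_or eq_sym -lt0n /=.
rewrite path_sortedE => [|a b c ba cb]; last exact: leq_trans cb ba.
have -> : (x + sumn q == n)%N = (x <= n)%N && (sumn q == n - x)%N by lia.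
rewrite (eq_all (a2 := fun y => (y <= x)%N)) //.
by case: (0 < x)%N; case: (x <= n)%N; case: all; case: sorted; case: (_ \notin _);
  rewrite /= ?andbF ?andbT.
Qed.

Lemma mem_desc m n q :
  (q \in desc m n) = is_partition n q && all (fun x => (x <= m)%N) q.
Proof.
elim: m n q => [|m IHm] n q.
  case: q => [|x q]; first by case: n.
  rewrite is_partition_cons; case: x => [|x]; first by case: n.
  by rewrite [all _ _]/= andbF; case: n.
elim/ltn_ind: n q => n IHn q; rewrite descS mem_cat IHm.
case: q => [|x q].
  by case: ifP => // _; rewrite [X in X || _](_ : _ = false) //; apply/mapP => -[].
(* A head [m.+1] can only come from the first block, any other head only from the second. *)
have [->|xm] := eqVneq x m.+1.
  have -> : all (fun y => (y <= m)%N) (m.+1 :: q) = false by rewrite /= ltnn.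
  rewrite andbF orbF is_partition_cons /= leqnn /=.
  case: ifP => //= mn; rewrite mem_map => [|? ? []] //.
  rewrite IHn; last by lia.
  by rewrite -andbA andbb.
rewrite [X in X || _](_ : _ = false) => [|]; last first.
  by case: ifP => // _; apply/mapP => -[q' _ [xE _]]; rewrite xE eqxx in xm.
rewrite orFb; apply: andb_id2l; rewrite is_partition_cons => /and4P[_ _ _ qx].
rewrite /= [RHS](_ : _ = (x <= m)%N && all (fun y => (y <= m.+1)%N) q); last by lia.
(* Both bounds on the tail follow from [qx], since the head satisfies [x <= m]. *)
apply: andb_id2l => xm'; apply/idP/idP => _; apply: sub_all qx => y yx; lia.
Qed.

Lemma desc_uniq m n : uniq (desc m n).
Proof.
elim: m n => [|m IHm] n; first by case: n.
elim/ltn_ind: n => n IHn; rewrite descS; case: ifP => [mn|_]; last exact: IHm.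
rewrite cat_uniq IHm map_inj_uniq ?IHn; try lia; last by move=> ? ? [].
rewrite andbT; apply/hasPn => q; rewrite mem_desc => /andP[_ qm].
by apply/mapP => -[q' _ qE]; rewrite qE /= ltnn in qm.
Qed.

Lemma size_desc m n : (n <= m)%N -> size (desc m n) = p n.
Proof.
move=> nm; apply: p_enum (desc_uniq m n) _ => q.
rewrite mem_desc andb_idr // => /is_partition_bounds[_]; apply: sub_all => x.
by rewrite ltnS => /leq_trans; apply.
Qed.

(** * Counting the reads *)

Definition cost (m n : nat) : nat := \sum_(q <- desc m n) (count_mem 1%N q).+1.

(** As [0 < m], the leading part [m.+1] is not 1, so prefixing it keeps the number of ones. *)
Lemma costS m n : (0 < m)%N -> (m < n)%N ->
  cost m.+1 n = (cost m.+1 (n - m.+1) + cost m n)%N.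
Proof.
move=> m0 mn; rewrite /cost descS mn big_cat big_map /=; congr addn.
by apply: eq_bigr => q _; rewrite eqSS; case: m m0 {mn}.
Qed.

Lemma cost1 n : cost 1 n = n.+1.
Proof. by rewrite /cost desc1 big_seq1 count_nseq /= mul1n. Qed.

(** The term [x = n] counts the partitions, the terms [x < n] their parts equal to 1. Keeping the
    bound [m] lets both sides follow the recursion of [descS]. *)
Lemma cost_size m n :
  (0 < m)%N -> cost m n = (\sum_(0 <= x < n.+1) size (desc m x))%N.
Proof.
case: m => // m _; elim: m n => [|m IHm] n.
  rewrite cost1 (eq_bigr (fun=> 1%N)) => [|x _]; last by rewrite desc1.
  by rewrite sum_nat_const_nat subn0 muln1.
elim/ltn_ind: n => n IHn.
under eq_bigr do rewrite descS size_cat.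
rewrite big_split /= -IHm; have [mn|nm] := ltnP m.+1 n; last first.
  rewrite big_nat big1 ?add0n => [|x /andP[_ xn]]; last by case: ifP => //; lia.
  by rewrite /cost descS ltnNge nm.
rewrite costS // IHn; last by lia.
(* Indices [x < m.+2] contribute nothing, as [m.+2] cannot be a part; shifting the others by [m.+2]
   gives the sum up to [n - m.+2]. *)
congr addn; rewrite [RHS](big_cat_nat _ (n := m.+2)) //=; last by lia.
rewrite [in RHS]big_nat [X in (_ = X + _)%N]big1 ?add0n => [|x /andP[_ xm]].
  rewrite -[X in _ = bigop _ (index_iota X _) _]add0n big_addn.
  rewrite (_ : n.+1 - m.+2 = (n - m.+2).+1)%N; last lia.
  apply: eq_bigr => x _; rewrite ifT ?size_map ?addnK //; lia.
by case: ifP => //; lia.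
Qed.

(** * Greedy partitions and their representation in the array *)

(** For [0 < m] this is copies of [m] followed by any positive remainder, and the default [[::]] is
    never reached. *)
Definition greedy (m n : nat) : seq nat := head [::] (desc m n).

Lemma greedy_ge m n : (0 < m <= n)%N -> greedy m n = m :: greedy m (n - m).
Proof.
case: m => // m /= mn; rewrite /greedy {1}descS mn.
by case: (desc m.+1 _) (@desc_neq_nil m.+1 (n - m.+1) isT).
Qed.

Lemma greedy_le m n : (0 < n <= m)%N -> greedy m n = [:: n].
Proof.
elim: m => [|m IHm]; first by case: n.
move=> /andP[n0 nm]; rewrite /greedy descS; case: ltnP => mn.
  have -> : n = m.+1 by lia.
  by rewrite subnn desc_n0.
by apply: IHm; rewrite n0.
Qed.

Definition holds_prefix (s : state) (q : seq nat) : Prop :=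
  forall i, (i < size q)%N -> arr s i.+1%:Z = (nth 0%N q i)%:Z.

Definition represents (s : state) (q : seq nat) : Prop :=
  env s K = (size q)%:Z /\ holds_prefix s q.

Lemma holds_prefix_cat s q1 q2 : holds_prefix s (q1 ++ q2) -> holds_prefix s q1.
Proof.
by move=> H i iq; rewrite H ?size_cat ?ltn_addr // nth_cat iq.
Qed.

Lemma holds_prefix_rcons s q x : holds_prefix s q ->
  holds_prefix (set_arr s (size q).+1%:Z x%:Z) (rcons q x).
Proof.
move=> H i; rewrite size_rcons ltnS nth_rcons /= eqz_nat eqSS.
by case: ltngtP => // iq _; rewrite H.
Qed.

Lemma represents_last s q x :
  represents s (rcons q x) -> arr s (env s K) = x%:Z.
Proof.
by move=> [-> H]; rewrite size_rcons H ?size_rcons // nth_rcons ltnn eqxx.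
Qed.

(** * Runs of the inner loops and of one main step *)

Definition skip_ones : cmd :=
  (while M = 1%:Z do K <-- K - 1%:Z;; M <-- d[K] od)%prog.

Definition refill : cmd :=
  (while M < N' do d[K] <-- M;; N' <-- N' - M;; K <-- K + 1%:Z od)%prog.

Definition main_body : cmd :=
  (L <-- K;; M <-- d[K];; skip_ones;;
   N' <-- M + L - K;; M <-- M - 1%:Z;; refill;;
   d[K] <-- N';; Visit K)%prog.

Definition main_loop (n : nat) : cmd := (while K != n%:Z do main_body od)%prog.

(** Each iteration drops one trailing 1 and costs one read; [1 < m] stops the loop at [m]. *)
Lemma runs_skip_ones s pre m j : (1 < m)%N ->
    represents s (pre ++ m :: nseq j 1%N) -> env s M = arr s (env s K) ->
  exists s', [/\ runs skip_ones s j s', env s' K = (size pre).+1%:Z,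
    env s' M = m%:Z, env s' L = env s L & arr s' = arr s].
Proof.
move=> m1; elim: j s => [|j IHj] s.
  rewrite cats1 => Hs; rewrite (represents_last Hs) => Ms; exists s; split=> //.
    by apply: runs_while_false; rewrite /= Ms eqz_nat gtn_eqF.
  by case: Hs => ->; rewrite size_rcons.
have -> : pre ++ m :: nseq j.+1 1%N = rcons (pre ++ m :: nseq j 1%N) 1%N.
  by rewrite -addn1 nseqD cats1 -rcons_cons rcons_cat.
move=> Hs; rewrite (represents_last Hs) => Ms.
pose s1 := set_var s K (env s K - 1); pose s2 := set_var s1 M (arr s1 (env s1 K)).
have [||s3 [run3 K3 M3 L3 A3]] := IHj s2 => //.
  split=> [|i iq] /=; last first.
    by apply: (@holds_prefix_cat s _ [:: 1%N]) => //; rewrite cats1; case: Hs.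
  by case: Hs => -> _; rewrite size_rcons -addn1 PoszD addrK.
exists s3; split=> //; rewrite -add1n; apply: runs_while_true run3.
  by rewrite /= Ms.
apply: (runs_seq (runs_assign s K _)); exact: (runs_read s1 M K).
Qed.

(** The loop exits before the last part is stored, so the conclusion anticipates the write of [N']
    to cell [K] that follows it. *)
Lemma runs_refill s pre m n : (0 < m)%N -> (0 < n)%N ->
    env s K = (size pre).+1%:Z -> env s M = m%:Z -> env s N' = n%:Z ->
    holds_prefix s pre ->
  exists2 s', runs refill s 0 s'
    & represents (set_arr s' (env s' K) (env s' N')) (pre ++ greedy m n).
Proof.
move=> m0; elim/ltn_ind: n s pre => n IHn s pre n0 Ks Ms Ns Hs.
have [mn|nm] := ltnP m n; last first.
  exists s; first by apply: runs_while_false; rewrite /= Ms Ns ltz_nat -leqNgt.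
  rewrite greedy_le ?n0 // cats1 Ks Ns; split; first by rewrite /= size_rcons.
  exact: holds_prefix_rcons.
rewrite greedy_ge; last by rewrite m0 ltnW.
rewrite -cat_rcons.
pose s1 := set_arr s (env s K) (env s M).
pose s2 := set_var s1 N' (env s1 N' - env s1 M).
pose s3 := set_var s2 K (env s2 K + 1).
have [||||||s4 run4 Hs4] := IHn (n - m)%N _ s3 (rcons pre m) => //=; try lia.
- by rewrite Ks size_rcons; lia.
- rewrite /holds_prefix /= Ks Ms; exact: holds_prefix_rcons.
exists s4 => //; rewrite -[0%N]addn0; apply: runs_while_true run4.
  by rewrite /= Ms Ns ltz_nat.
rewrite -[0%N]addn0; apply: runs_seq (runs_write s K M) _; rewrite -[0%N]addn0.
apply: (runs_seq (runs_assign s1 N' _)); exact: (runs_assign s2 K).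
Qed.

(** The reads are the initial one and one per skipped 1; the total [m.+1 + j] of the removed parts
    is redistributed greedily into parts at most [m]. *)
Lemma runs_main_body s pre m j : (0 < m)%N ->
    represents s (pre ++ m.+1 :: nseq j 1%N) ->
  exists2 s', runs main_body s j.+1 s'
    & represents s' (pre ++ greedy m (m.+1 + j)).
Proof.
move=> m0 Hs; pose s1 := set_var s L (env s K).
pose s2 := set_var s1 M (arr s1 (env s1 K)).
have [s3 [run3 K3 M3 L3 A3]] := @runs_skip_ones s2 pre m.+1 j m0 Hs (erefl _).
pose s4 := set_var s3 N' (env s3 M + env s3 L - env s3 K).
pose s5 := set_var s4 M (env s4 M - 1).
have [|||||s6 run6 Hs6] := @runs_refill s5 pre m (m.+1 + j) m0 => //=.
- by rewrite M3; lia.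
(* [L] holds the old length [size pre + 1 + j], so [M + L - K] is [m.+1 + j]. *)
- by rewrite M3 L3 K3 /=; case: Hs => -> _; rewrite size_cat /= size_nseq; lia.
- move=> i iq; rewrite /= A3; case: Hs => _ /holds_prefix_cat; exact.
exists (set_arr s6 (env s6 K) (env s6 N')) => //.
rewrite -[j.+1]add0n; apply: runs_seq (runs_assign s L _) _; rewrite -[j.+1]add1n.
apply: runs_seq (runs_read s1 M _) _; rewrite -[j]addn0.
apply: runs_seq run3 _; rewrite -[0%N]addn0.
apply: runs_seq (runs_assign s3 N' _) _; rewrite -[0%N]addn0.
apply: runs_seq (runs_assign s4 M _) _; rewrite -[0%N]addn0.
apply: runs_seq run6 _; rewrite -[0%N]addn0.
by apply: (runs_seq (runs_write s6 K N')); exact: runs_visit.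
Qed.

(** All parts are positive and one exceeds 1, so there are fewer than [n] of them; this makes the
    test [K != n] succeed. *)
Lemma size_lt_sumn_cat_gt1 pre m j n : (0 < m)%N ->
  0%N \notin pre -> (sumn pre + (m.+1 + j) = n)%N ->
  (size (pre ++ m.+1 :: nseq j 1%N) < n)%N.
Proof.
move=> m0 + <-; rewrite size_cat /= size_nseq; elim: pre => [|x q IHq] /=.
  by lia.
by rewrite in_cons negb_or => /andP[x0 /IHq]; lia.
Qed.

(** * The complete run and its total *)

(* Starting from the first partition that extends pre by parts at most m, the
   main loop goes through all of them; the last one, pre ++ 1^n, is reached but
   not left, hence its cost n + 1 is not incurred. *)
Lemma runs_desc N m n pre s : (0 < m)%N ->
    0%N \notin pre -> (sumn pre + n = N)%N ->
    represents s (pre ++ greedy m n) ->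
  exists r s1, [/\ represents s1 (pre ++ nseq n 1%N), (r + n.+1 = cost m n)%N &
    forall r' s2, runs (main_loop N) s1 r' s2 -> runs (main_loop N) s (r + r') s2].
Proof.
case: m => // m _; elim: m n pre s => [|m IHm] n pre s.
  move=> _ _; rewrite /greedy desc1 /= => Hs.
  by exists 0%N, s; rewrite cost1; split.
elim/ltn_ind: n pre s => n IHn pre s pre0 sumN Hs.
have [nm|mn] := leqP n m.+1.
  have [|r [s1 [Hs1 rE Hrun]]] := IHm n pre s pre0 sumN.
    by move: Hs; rewrite /greedy descS ltnNge nm.
  by exists r, s1; rewrite /cost descS ltnNge nm.
(* The first block, with [m.+2] appended to [pre], ends at [pre], [m.+2], 1, ..., 1. *)
have [||||r1 [s1 [Hs1 r1E run1]]] := IHn (n - m.+2)%N _ (rcons pre m.+2) s.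
- by lia.
- by rewrite mem_rcons in_cons negb_or pre0.
- by rewrite sumn_rcons; lia.
- by rewrite cat_rcons -greedy_ge.
(* One main step leads to the first partition of the second block; its [(n - m.+2).+1] reads are the
   cost left out of [r1]. *)
have [|s2 run2 Hs2] := @runs_main_body s1 pre m.+1 (n - m.+2) isT.
  by rewrite -cat_rcons.
rewrite subnKC // in Hs2.
have [r3 [s3 [Hs3 r3E run3]]] := IHm n pre s2 pre0 sumN Hs2.
exists (r1 + (n - m.+2).+1 + r3)%N, s3; split => //.
  by rewrite costS // -r1E -r3E; lia.
move=> r' s4 /run3 run4; rewrite -!addnA; apply: run1.
apply: runs_while_true run2 run4 => /=.
case: Hs1 => -> _; rewrite eqz_nat neq_ltn cat_rcons size_lt_sumn_cat_gt1 //.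
by lia.
Qed.

Lemma runs_RuleDesc n s : (0 < n)%N ->
  exists2 r, (r + n = \sum_(1 <= x < n.+1) p x)%N
    & exists s', runs (RuleDesc n) s r s'.
Proof.
move=> n0.
pose s0 := set_var (set_arr s 1%:Z n%:Z) K 1%:Z.
have Hs0 : represents s0 ([::] ++ greedy n n).
  by rewrite greedy_le ?n0 //=; split => // -[].
have [r [s1 [[Ks1 _] rE run1]]] :=
  @runs_desc n n n [::] s0 n0 isT (add0n n) Hs0.
exists r.
  (* The term [x = 0], equal to [p 0 = 1], cancels the extra 1 in [n.+1]. *)
  move: rE; rewrite cost_size // big_ltn //= size_desc // -(size_desc (leqnn 0)) /=.
  rewrite (eq_big_nat _ _ (F2 := p)) => [|x /andP[_ xn]]; first by lia.
  by rewrite size_desc.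
exists s1; rewrite -[r]addn0 -[X in runs _ _ X]add0n.
apply: runs_seq (runs_write _ _ _) _; rewrite -[X in runs _ _ X]add0n.
apply: runs_seq (runs_assign _ _ _) _; rewrite -[X in runs _ _ X]add0n.
apply: runs_seq (runs_visit _ _) _; apply: run1; apply: runs_while_false.
by rewrite /= Ks1 size_nseq eqxx.
Qed.

(* RuleDesc is run from an arbitrary initial state: no assumption is made on
   the initial contents of the variables and of the array. *)
Theorem theorem3p11 (n : nat) (n_gt0 : (0 < n)%N) (s : state) :
  (exists t s', exec (RuleDesc n) s t s') /\
  (forall t s', exec (RuleDesc n) s t s' ->
     (count is_read t)%:Z = (\sum_(1 <= x < n.+1) p x)%N%:Z - n%:Z).
Proof.
have [r rE [s' [t Et rt]]] := runs_RuleDesc s n_gt0.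
split=> [|t' s'' Et']; first by exists t, s'.
have [<- _] := exec_deterministic Et Et'.
by rewrite rt -rE PoszD addrK.
Qed.
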